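(* There exists a homeomorphism $F:B^+(\mathbb{N})\to B(\mathbb{N})$ such that $\sum_n|F(x)_n|=\sum_n x_n$ for all $x\in B^+(\mathbb{N})$.
   Context: $B(\mathbb{N})=\{x\in[-1,1]^{\mathbb{N}}:\sum_n|x_n|\le 1\}$ and $B^+(\mathbb{N})=B(\mathbb{N})\cap[0,1]^{\mathbb{N}}$, both with the topology inherited from the product topology. *)

(* Defs.v *)
From HB Require Import structures.
From mathcomp Require Import all_boot all_order all_algebra.
From mathcomp Require Import all_classical all_reals all_analysis.
Import Order.TTheory GRing.Theory Num.Theory.
Import numFieldNormedType.Exports.

Local Open Scope classical_set_scope.
Local Open Scope ring_scope.

(* The sets [B R] and [Bplus R] coerce to types carrying the topology induced
   by the product topology of {ptws nat -> R}.
   The sum of a nonnegative sequence is taken in \bar R, so that a divergent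
   sum is +oo. *)
Definition B (R : realType) : set {ptws nat -> R} :=
  [set x | (forall n, x n \in `[-1, 1]) /\
           (\sum_(0 <= n <oo) `|x n|%:E <= 1)%E].

Definition Bplus (R : realType) : set {ptws nat -> R} :=
  B R `&` [set x | forall n, x n \in `[0, 1]].

Definition homeomorphism {S T : topologicalType} (f : S -> T) : Prop :=
  continuous f /\
  exists g : T -> S, [/\ cancel f g, cancel g f & continuous g].

(* Main.v *)
(** Two nonnegative coordinates [a, b] are traded for the signed coordinate
    [a - b] and the nonnegative residue [2 * min a b]; this preserves the sum of
    absolute values and is inverted by [a = (a - b)^+ + min a b],
    [b = (a - b)^- + min a b].  Starting with the residue [x 0] and trading the
    residue successively against [x 1, x 2, ...] turns [x] into a signed
    sequence [y].  The residue [s n] is at most [2 * x n], so it tends to [0]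
    and the sums agree in the limit.  Conversely
    [s n = (y n)^+ + s (n + 1) / 2], so [s n = \sum_k (y (n + k))^+ / 2 ^ k],
    which is a uniform limit of continuous functions of [y]. *)
Require Import Defs.
From mathcomp Require Import all_boot all_order all_algebra.
From mathcomp Require Import all_classical all_reals all_analysis.
From mathcomp Require Import ring lra.
Import Order.TTheory GRing.Theory Num.Theory.
Import numFieldNormedType.Exports.
Local Open Scope classical_set_scope.
Local Open Scope ring_scope.

(** * The forward map, its inverse and their auxiliary sequences *)

Fixpoint residue {R : realType} (x : nat -> R) (n : nat) : R :=
  if n is m.+1 then 2 * Num.min (residue x m) (x n) else x 0%N.

Definition signed_seq {R : realType} (x : nat -> R) (n : nat) : R :=
  residue x n - x n.+1.

Definition dyadic_sum {R : realType} (y : nat -> R) (n N : nat) : R :=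
  \sum_(0 <= k < N) Num.max (y (n + k)%N) 0 / 2 ^+ k.

(** [limn] has its intended meaning only for a convergent sequence; [is_cvg_dyadic_sum] provides
    this for [y] in [B R]. *)
Definition dyadic_tail {R : realType} (y : nat -> R) (n : nat) : R :=
  limn (dyadic_sum y n).

Definition unsigned_seq {R : realType} (y : nat -> R) (n : nat) : R :=
  if n is m.+1 then Num.max (- y m) 0 + dyadic_tail y n / 2
  else dyadic_tail y 0%N.

(** Partial sums of a nonnegative series increase to its value; this trades bounds in [\bar R] for
    bounds on finite real sums. *)
Lemma nneseries_EFin_leP (R : realType) (u : nat -> R) (c : R) :
  (forall n, 0 <= u n) ->
  (\sum_(0 <= n <oo) (u n)%:E <= c%:E)%E <->
  (forall n, \sum_(0 <= i < n) u i <= c).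
Proof.
move=> u0; have u0' n : (0 <= n)%N -> xpredT n -> (0 <= (u n)%:E)%E.
  by rewrite lee_fin.
split=> [h n|h].
  rewrite -lee_fin -sumEFin; apply: le_trans h.
  exact: nneseries_lim_ge.
apply: lime_le; first exact: is_cvg_nneseries.
by apply: nearW => n; rewrite sumEFin lee_fin.
Qed.

(** The coordinate bounds are recovered because [|x n|] is at most the partial sum ending with
    it. *)
Lemma B_sumP (R : realType) (x : nat -> R) :
  B R x <-> forall n, \sum_(0 <= i < n) `|x i| <= 1.
Proof.
split=> [[_ h]|h].
  by apply/nneseries_EFin_leP.
split; last exact/nneseries_EFin_leP.
move=> n; rewrite in_itv /= -ler_norml.
apply: le_trans (h n.+1); rewrite big_nat_recr //= lerDr.
by apply: sumr_ge0.
Qed.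

Lemma Bplus_sumP (R : realType) (x : nat -> R) :
  Bplus R x <->
  (forall n, 0 <= x n) /\ forall n, \sum_(0 <= i < n) x i <= 1.
Proof.
have absE : (forall n, 0 <= x n) -> forall n,
    \sum_(0 <= i < n) `|x i| = \sum_(0 <= i < n) x i.
  by move=> x0 n; apply: eq_bigr => i _; rewrite ger0_norm.
split=> [[/B_sumP h x01]|[x0 h]].
  have x0 n : 0 <= x n by have := x01 n; rewrite in_itv /= => /andP[].
  by split=> // n; rewrite -absE.
have Bx : B R x by apply/B_sumP => n; rewrite absE.
split=> // n; rewrite /= in_itv /= x0 /=.
by have := Bx.1 n; rewrite in_itv /= => /andP[].
Qed.

(** * Algebra of a single trade *)

Section Residue.
Context {R : realType} (x : nat -> R).

(** Each trade conserves the total, by |a - b| + 2 min(a, b) = a + b. After [n] trades, [n.+1]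
    entries of [x] are consumed, since the initial residue is [x 0]. *)
Lemma sum_abs_signed_seq (n : nat) :
  \sum_(0 <= i < n) `|signed_seq x i| + residue x n = \sum_(0 <= i < n.+1) x i.
Proof.
elim: n => [|n IHn]; first by rewrite big_nat1 big_geq // add0r.
rewrite [RHS]big_nat_recr //= -IHn big_nat_recr //= /signed_seq.
case: leP => h; [rewrite ler0_norm; last by lra | rewrite gtr0_norm; last by lra].
  by ring.
by ring.
Qed.

Lemma residue_ge0 : (forall n, 0 <= x n) -> forall n, 0 <= residue x n.
Proof.
move=> x0; elim=> [|n IHn] /=; first exact: x0.
by rewrite mulr_ge0 // le_min IHn x0.
Qed.

Lemma residue_le (n : nat) : residue x n.+1 <= 2 * x n.+1.
Proof. by rewrite /= ler_pM2l // ge_min lexx orbT. Qed.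

(** This is a = (a - b)^+ + min(a, b), the half of the inversion that determines the residues from
    the signed sequence. *)
Lemma residue_rec (n : nat) :
  residue x n = Num.max (signed_seq x n) 0 + residue x n.+1 / 2.
Proof. by rewrite /signed_seq /=; case: leP => h; case: leP => h'; lra. Qed.

Lemma signed_seq_neg (n : nat) :
  x n.+1 = Num.max (- signed_seq x n) 0 + residue x n.+1 / 2.
Proof. by rewrite /signed_seq /=; case: leP => h; case: leP => h'; lra. Qed.

End Residue.

(** * The inverse map on [B R] *)

Section DyadicTail.
Context {R : realType} (y : nat -> R).

Lemma dyadic_sum_recl (n N : nat) :
  dyadic_sum y n N.+1 = Num.max (y n) 0 + dyadic_sum y n.+1 N / 2.
Proof.
rewrite /dyadic_sum big_nat_recl // addn0 expr0 divr1; congr (_ + _).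
rewrite mulr_suml; apply: eq_bigr => k _.
by rewrite addSnnS exprS invfM; ring.
Qed.

(** Stated for an arbitrary solution [s] of the recursion because it serves both [residue x] and
    [dyadic_tail y]. *)
Lemma dyadic_sum_unroll (s : nat -> R) :
  (forall n, s n = Num.max (y n) 0 + s n.+1 / 2) ->
  forall n N, s n = dyadic_sum y n N + s (n + N)%N / 2 ^+ N.
Proof.
move=> sE n N; elim: N n => [|N IHN] n.
  by rewrite /dyadic_sum big_geq // addn0 expr0 divr1 add0r.
by rewrite dyadic_sum_recl sE (IHN n.+1) addSnnS exprS invfM; ring.
Qed.

Lemma dyadic_sum_nondecreasing (n : nat) : nondecreasing_seq (dyadic_sum y n).
Proof.
apply/nondecreasing_seqP => N; rewrite /dyadic_sum big_nat_recr //= lerDl.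
by rewrite divr_ge0 ?exprn_ge0 // le_max lexx orbT.
Qed.

(** The weights are at most 1 and a positive part is at most the absolute value, so the dyadic sum
    is dominated by the next [N] terms. *)
Lemma dyadic_sum_le (n N : nat) :
  \sum_(0 <= i < n) `|y i| + dyadic_sum y n N <= \sum_(0 <= i < n + N) `|y i|.
Proof.
elim: N => [|N IHN]; first by rewrite /dyadic_sum [X in _ + X]big_geq // addr0 addn0.
rewrite addnS [leRHS]big_nat_recr //= /dyadic_sum big_nat_recr //= addrA.
apply: lerD; first exact: IHN.
apply: (@le_trans _ _ (Num.max (y (n + N)%N) 0)).
  rewrite ler_pdivrMr ?exprn_gt0 // ler_peMr ?exprn_ege1 ?ler1n //.
  by rewrite le_max lexx orbT.
by rewrite ge_max ler_norm normr_ge0.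
Qed.

Hypothesis By : B R y.

Lemma sum_abs_dyadic_sum_le1 (n N : nat) :
  \sum_(0 <= i < n) `|y i| + dyadic_sum y n N <= 1.
Proof. by apply: le_trans (dyadic_sum_le n N) _; move/B_sumP: By; apply. Qed.

Lemma is_cvg_dyadic_sum (n : nat) : cvgn (dyadic_sum y n).
Proof.
apply: nondecreasing_is_cvgn; first exact: dyadic_sum_nondecreasing.
exists 1 => _ [N _ <-]; apply: le_trans (sum_abs_dyadic_sum_le1 n N).
by rewrite lerDr sumr_ge0.
Qed.

Lemma dyadic_tail_rec (n : nat) :
  dyadic_tail y n = Num.max (y n) 0 + dyadic_tail y n.+1 / 2.
Proof.
apply/cvg_lim => //; rewrite -cvg_shiftS /=.
under eq_cvg do rewrite dyadic_sum_recl.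
apply: cvgD; first exact: cvg_cst.
by apply: cvgM; [exact: is_cvg_dyadic_sum | exact: cvg_cst].
Qed.

Lemma dyadic_tail_ge0 (n : nat) : 0 <= dyadic_tail y n.
Proof.
apply: limr_ge; first exact: is_cvg_dyadic_sum.
apply: nearW => N; apply: sumr_ge0 => k _.
by rewrite divr_ge0 ?exprn_ge0 // le_max lexx orbT.
Qed.

(** The left side is the conserved total of [sum_abs_signed_seq] for [unsigned_seq y], which bounds
    the partial sums of the latter. *)
Lemma sum_abs_dyadic_tail_le1 (n : nat) :
  \sum_(0 <= i < n) `|y i| + dyadic_tail y n <= 1.
Proof.
rewrite -lerBrDl; apply: limr_le; first exact: is_cvg_dyadic_sum.
by apply: nearW => N; rewrite lerBrDl sum_abs_dyadic_sum_le1.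
Qed.

Lemma dyadic_tail_le1 (n : nat) : dyadic_tail y n <= 1.
Proof.
by apply: le_trans (sum_abs_dyadic_tail_le1 n); rewrite lerDr sumr_ge0.
Qed.

(** The two traded numbers are (y n)^+ + t and (y n)^- + t with t half the next tail. One of the two
    parts is 0, so their minimum is t, and doubling it gives the next tail. *)
Lemma residue_unsigned_seq (n : nat) :
  residue (unsigned_seq y) n = dyadic_tail y n.
Proof.
elim: n => [//|n IHn]; rewrite /= IHn [X in Num.min X]dyadic_tail_rec.
by case: (leP (y n) 0) => h; case: leP => h' //=; case: leP; lra.
Qed.

Lemma unsigned_seqK : signed_seq (unsigned_seq y) = y.
Proof.
apply/funext => n; rewrite /signed_seq residue_unsigned_seq dyadic_tail_rec /=.
by case: leP => h; case: leP => h'; lra.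
Qed.

Lemma Bplus_unsigned_seq : Bplus R (unsigned_seq y).
Proof.
apply/Bplus_sumP; split=> [[|n]|[|n]] /=.
- exact: dyadic_tail_ge0.
- by rewrite addr_ge0 ?divr_ge0 ?dyadic_tail_ge0 // le_max lexx orbT.
- by rewrite big_geq.
- rewrite -sum_abs_signed_seq unsigned_seqK residue_unsigned_seq.
  exact: sum_abs_dyadic_tail_le1.
Qed.

End DyadicTail.

(** * The forward map on [Bplus R] *)

Section SignedSeq.
Context {R : realType} (x : nat -> R).
Hypothesis Bx : Bplus R x.

Let x0 : forall n, 0 <= x n. Proof. by move/Bplus_sumP: Bx => []. Qed.
Let sumx : forall n, \sum_(0 <= i < n) x i <= 1.
Proof. by move/Bplus_sumP: Bx => []. Qed.

Lemma B_signed_seq : B R (signed_seq x).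
Proof.
apply/B_sumP => n; apply: le_trans (sumx n.+1).
by rewrite -sum_abs_signed_seq lerDl residue_ge0.
Qed.

Lemma residue_le1 (n : nat) : residue x n <= 1.
Proof.
apply: le_trans (sumx n.+1).
by rewrite -sum_abs_signed_seq lerDr sumr_ge0.
Qed.

(** Unrolling [residue_rec] [N] times leaves a remainder in [0, 2^-N], because residues lie in
    [0, 1]. *)
Lemma dyadic_tail_signed_seq (n : nat) :
  dyadic_tail (signed_seq x) n = residue x n.
Proof.
apply/cvg_lim => //; apply: (@squeeze_cvgr _ _ _ _ (fun N => residue x n - 2^-1 ^+ N)
   (cst (residue x n))); last 2 first.
- rewrite -[X in _ --> X]subr0; apply: cvgB; first exact: cvg_cst.
  by apply: cvg_expr; rewrite gtr0_norm; lra.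
- exact: cvg_cst.
apply: nearW => N.
have := dyadic_sum_unroll (signed_seq x) (residue x) (residue_rec x) n N.
have e0 : 0 < (2 ^+ N)^-1 :> R by rewrite invr_gt0 exprn_gt0.
have := residue_ge0 x x0 (n + N); have := residue_le1 (n + N).
rewrite exprVn /cst => r1 r0 ->; apply/andP; split; nra.
Qed.

Lemma signed_seqK : unsigned_seq (signed_seq x) = x.
Proof.
apply/funext => -[|n] /=; rewrite dyadic_tail_signed_seq //.
by rewrite [RHS]signed_seq_neg.
Qed.

Let cx : cvgn (series x).
Proof.
apply: nondecreasing_is_cvgn; last by exists 1 => _ [n _ <-]; exact: sumx.
by apply/nondecreasing_seqP => n; rewrite seriesSr lerDl.
Qed.

Lemma cvg_residue : residue x @ \oo --> (0 : R).
Proof.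
have x_cvg0 : 2 * x n @[n --> \oo] --> (0 : R).
  rewrite -[X in _ --> X](mulr0 2).
  by apply: cvgM; [exact: cvg_cst | apply: cvg_series_cvg_0].
(* Both sequences are shifted because [residue_le] is stated at successor indices. *)
move: x_cvg0; rewrite -cvg_shiftS -[X in _ -> X]cvg_shiftS => x_cvg0.
apply: squeeze_cvgr (cvg_cst _) x_cvg0.
by apply: nearW => n; rewrite residue_ge0 // residue_le.
Qed.

Lemma nneseries_abs_signed_seq :
  (\sum_(0 <= n <oo) `|signed_seq x n|%:E = \sum_(0 <= n <oo) (x n)%:E)%E.
Proof.
have cy : series (fun n => `|signed_seq x n|) @ \oo --> limn (series x).
  have -> : series (fun n => `|signed_seq x n|) =
      (fun n => series x n.+1 - residue x n).
    by apply/funext => n; rewrite -[series x n.+1]/(\sum_(0 <= i < n.+1) x i) -sum_abs_signed_seq addrK.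
  rewrite -[X in _ --> X]subr0; apply: cvgB; last exact: cvg_residue.
  by rewrite cvg_shiftS.
(* Both extended sums are the image of one finite real limit. *)
transitivity (limn (series x))%:E; last rewrite -EFin_lim //.
  apply/cvg_lim => //; under eq_cvg do rewrite sumEFin.
  by apply: cvg_EFin => //; exact: nearW.
by congr (limn _); apply/funext => n; rewrite /= sumEFin.
Qed.

End SignedSeq.

(** * Continuity, coordinate by coordinate *)

Section Continuity.
Context {R : realType}.

Lemma continuous_coord (n : nat) :
  continuous (fun x : {ptws nat -> R} => x n : R).
Proof. exact: (@proj_continuous nat (fun=> R) n). Qed.

(** The topology of [A] is initial for [set_val], and convergence in the product is pointwise. *)
Lemma continuous_into_ptws_set (S : topologicalType) (A : set {ptws nat -> R})
    (f : S -> A) :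
  (forall n, continuous (fun s => set_val (f s) n : R)) -> continuous f.
Proof.
move=> cf; apply: continuous_comp_initial => s.
by apply/pointwise_cvgP => n; exact: cf.
Qed.

Lemma continuous_coord_set (A : set {ptws nat -> R}) (n : nat) :
  continuous (fun x : A => set_val x n : R).
Proof.
move=> x.
have := continuous_coord n (set_val x).
have /continuous_comp := @initial_continuous A {ptws nat -> R} set_val x.
exact.
Qed.

Lemma continuous_residue (A : set {ptws nat -> R}) (n : nat) :
  continuous (fun x : A => residue (set_val x) n).
Proof.
elim: n => [|n IHn] x; first exact: continuous_coord_set.
apply: (@continuousM R A (cst 2)
  (fun x => Num.min (residue (set_val x) n) (set_val x n.+1))).
  exact: cst_continuous.
apply: (@continuous_min R _ (fun x : A => residue (set_val x) n)
  (fun x : A => set_val x n.+1)); first exact: IHn.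
exact: continuous_coord_set.
Qed.

Lemma continuous_signed_seq (A : set {ptws nat -> R}) (n : nat) :
  continuous (fun x : A => signed_seq (set_val x) n).
Proof.
move=> x; apply: (@continuousB _ _ _ (fun x : A => residue (set_val x) n)).
  exact: continuous_residue.
exact: continuous_coord_set.
Qed.

Lemma continuous_dyadic_sum (A : set {ptws nat -> R}) (n N : nat) :
  continuous (fun y : A => dyadic_sum (set_val y) n N).
Proof.
elim: N n => [|N IHN] n.
  rewrite [X in continuous X](_ : _ = cst 0).
    by move=> y; exact: cst_continuous.
  by apply/funext => z; rewrite /dyadic_sum big_geq.
rewrite [X in continuous X](_ : _ = fun z : A =>
  Num.max (set_val z n) 0 + dyadic_sum (set_val z) n.+1 N / 2); last first.
  by apply/funext => z; rewrite dyadic_sum_recl.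
move=> y; apply: (@continuousD _ _ _ (fun z : A => Num.max (set_val z n) 0)).
  apply: (@continuous_max R _ (fun z : A => set_val z n) (cst 0)).
    exact: continuous_coord_set.
  exact: cst_continuous.
apply: (@continuousM R A _ (cst 2^-1)); first exact: IHN.
exact: cst_continuous.
Qed.

(** On [B R] the truncation error is at most 2^-N at every point, since tails lie in [0, 1]; hence
    one [N] serves for [y] and all its neighbours. *)
Lemma continuous_dyadic_tail (n : nat) :
  continuous (fun y : B R => dyadic_tail (set_val y) n).
Proof.
move=> y; apply/(@cvgrPdist_lt _ _ _ (nbhs y)) => e e0.
have [N Ne] : exists N, (2 ^+ N)^-1 < e / 2.
  have : GRing.exp (2^-1 : R) @ \oo --> 0.
    by apply: cvg_expr; rewrite gtr0_norm; lra.
  move=> /cvgrPdist_lt /(_ (e / 2)); rewrite divr_gt0 // => /(_ isT) [N _ /(_ N)].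
  rewrite /= leqnn sub0r normrN exprVn ger0_norm ?invr_ge0 ?exprn_ge0 //.
  by move=> /(_ isT); exists N.
have tailE (z : B R) : 0 <= dyadic_tail (set_val z) n -
    dyadic_sum (set_val z) n N <= (2 ^+ N)^-1.
  have Bz := set_valP z.
  rewrite (dyadic_sum_unroll _ _ (dyadic_tail_rec _ Bz) n N) addrC addKr.
  rewrite divr_ge0 ?exprn_ge0 ?dyadic_tail_ge0 //=.
  by rewrite ler_piMl ?invr_ge0 ?exprn_ge0 ?dyadic_tail_le1.
have e2 : 0 < e / 2 by rewrite divr_gt0.
have /(@cvgrPdist_lt _ _ _ (nbhs y)) /(_ _ e2) :=
  continuous_dyadic_sum (B R) n N y.
(* The errors at [y] and [z] lie in the same interval [0, 2^-N], so they differ by less than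
   [e / 2]; the truncated sums account for the other [e / 2]. *)
apply: filterS => z; rewrite !ltr_norml.
have /andP[] := tailE y; have /andP[] := tailE z.
by move=> ? ? ? ? /andP[? ?]; apply/andP; split; lra.
Qed.

Lemma continuous_unsigned_seq (n : nat) :
  continuous (fun y : B R => unsigned_seq (set_val y) n).
Proof.
case: n => [|n] y /=; first exact: continuous_dyadic_tail.
apply: (@continuousD _ _ _ (fun y : B R => Num.max (- set_val y n) 0)); last first.
  apply: (@continuousM R (B R) _ (cst 2^-1)); first exact: continuous_dyadic_tail.
  exact: cst_continuous.
apply: (@continuous_max R _ (fun y : B R => - set_val y n) (cst 0)).
  by apply: (@continuousN _ R); exact: continuous_coord_set.
exact: cst_continuous.
Qed.

End Continuity.

Theorem corollary3 (R : realType) :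
  exists F : Bplus R -> B R,
    homeomorphism F /\
    forall x : Bplus R,
      (\sum_(0 <= n <oo) `|set_val (F x) n|%:E =
       \sum_(0 <= n <oo) (set_val x n)%:E)%E.

Proof.
pose F (x : Bplus R) : B R :=
  exist _ (signed_seq (set_val x)) (mem_set (B_signed_seq _ (set_valP x))).
pose G (y : B R) : Bplus R :=
  exist _ (unsigned_seq (set_val y)) (mem_set (Bplus_unsigned_seq _ (set_valP y))).
exists F; split; last by move=> x; exact: nneseries_abs_signed_seq (set_valP x).
split.
  by apply: continuous_into_ptws_set => n; exact: continuous_signed_seq.
exists G; split.
- by move=> x; apply: val_inj; exact: signed_seqK (set_valP x).
- by move=> y; apply: val_inj; exact: unsigned_seqK (set_valP y).
- by apply: continuous_into_ptws_set => n; exact: continuous_unsigned_seq.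
Qed.
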